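(* Assume that $\mathcal{F}$ is a remote filter of clopen sets of $\omega\times{}^{\omega}2$ (in the ground model $\mathbf{V}$). If $\mathbb{P}$ is any nwd-bounding forcing notion, then $\mathcal{F}$ is still (generates) a remote filter of clopen sets of $\omega\times{}^{\omega}2$ in the model obtained by forcing with $\mathbb{P}$.
   Context: ${}^{\omega}2$ is the Cantor set and $\omega\times{}^{\omega}2$ has the product topology with $\omega$ discrete. A remote filter of clopen sets of $\omega\times{}^{\omega}2$ is a (proper) filter $\mathcal{F}$ in the Boolean algebra of clopen subsets of $\omega\times{}^{\omega}2$ such that for every nowhere dense $N\subset\omega\times{}^{\omega}2$ there is $V\in\mathcal{F}$ with $V\cap N=\emptyset$. $\mathbf{V}$ denotes the ground model. A forcing notion $\mathbb{P}$ is nwd-bounding if whenever $p\in\mathbb{P}$ and $\dot{A}$ is a $\mathbb{P}$-name such that $p\Vdash$ ''$\dot{A}$ is closed and nowhere dense in ${}^{\omega}2$'', there are a closed nowhere dense subset $B$ of ${}^{\omega}2$ (in $\mathbf{V}$) and $q\leq p$ such that $q\Vdash$ ''$\dot{A}\subset B$''. As usual, a closed (or clopen) set of the ground model is identified in the extension with the closed (clopen) set having the same code, i.e. determined by the same family of basic open sets; in the extension, $\mathcal{F}$ refers to the filter generated by the reinterpreted members of $\mathcal{F}$. *)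

(* Defs.v *)
From HB Require Import structures.
From mathcomp Require Import all_boot all_order.
From mathcomp Require Import all_classical all_reals topology cantor.

Set Implicit Arguments.
Unset Strict Implicit.
Unset Printing Implicit Defensive.

Local Open Scope classical_set_scope.

Section Ground.
Variable T : topologicalType.

Definition nowhere_dense (A : set T) : Prop := interior (closure A) = set0.

Definition clopen_filter (F : set (set T)) : Prop :=
  [/\ F `<=` clopen,
      F setT,
      ~ F set0,
      (forall V W, F V -> F W -> F (V `&` W)) &
      (forall V W, F V -> V `<=` W -> clopen W -> F W)].

Definition remote_filter (F : set (set T)) : Prop :=
  clopen_filter F /\
  forall N, nowhere_dense N -> exists2 V, F V & V `&` N = set0.

End Ground.

(* The basic open subset of the Cantor set given by a finite binary sequence. *)
Definition cylinder (s : seq bool) : set cantor_space :=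
  [set x | forall i, i < size s -> x i = nth false s i].

(* A forcing notion is a preorder [P], where [q <= p] means that [q] is stronger
   than [p]. A formula of the forcing language is identified with the set of
   conditions forcing it: for [phi : fprop P], [phi p] reads "p forces phi".
   The ground model is the ambient type theory. *)
Definition fprop d (P : preorderType d) : Type := P -> Prop.

Section ForcingRelation.
Context {d : Order.disp_t} {P : preorderType d}.
Implicit Types (phi psi : fprop P) (p q r : P).

Definition dense_below phi : fprop P :=
  fun p => forall q, (q <= p)%O -> exists2 r, (r <= q)%O & phi r.

(* A statement about the ground model. *)
Definition fpure (a : Prop) : fprop P := fun=> a.

Definition fand phi psi : fprop P := fun p => phi p /\ psi p.

Definition fimp phi psi : fprop P :=
  fun p => forall q, (q <= p)%O -> phi q -> psi q.

Definition fnot phi : fprop P := fun p => forall q, (q <= p)%O -> ~ phi q.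

(* Quantification over [I] is quantification over the ground model set [I] if
   [I] is a type of ground model objects, and over the elements of the
   extension named by the members of [I] if [I] is a type of names. *)
Definition fall (I : Type) (phi : I -> fprop P) : fprop P :=
  fun p => forall i, phi i p.

Definition fex (I : Type) (phi : I -> fprop P) : fprop P :=
  dense_below (fun p => exists i, phi i p).

End ForcingRelation.

Declare Scope fprop_scope.
Delimit Scope fprop_scope with F.
Bind Scope fprop_scope with fprop.
Infix "/\f" := fand (at level 80, right associativity) : fprop_scope.
Infix "->f" := fimp (at level 99, right associativity) : fprop_scope.
Notation "~f phi" := (fnot phi) (at level 75, right associativity)
  : fprop_scope.
Notation "'forallf' x .. y , phi" := (fall (fun x => .. (fall (fun y => phi)) ..))
  (at level 200, x binder, y binder, right associativity) : fprop_scope.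
Notation "'existsf' x .. y , phi" := (fex (fun x => .. (fex (fun y => phi)) ..))
  (at level 200, x binder, y binder, right associativity) : fprop_scope.

Section Reals.
Context {d : Order.disp_t} (P : preorderType d).

(* A name for an element of the Cantor set, presented as a name
   {(n, p), ...} for the set of those n at which it takes the value 1
   (the value is 0 elsewhere). *)
Definition real_name : Type := set (nat * P).

Definition fbit (x : real_name) (n : nat) : fprop P :=
  dense_below (fun q => exists2 r, x (n, r) & (q <= r)%O).

Definition real_eq (x y : real_name) : fprop P :=
  (forallf n, (fbit x n ->f fbit y n) /\f (fbit y n ->f fbit x n))%F.

Definition fcylinder (s : seq bool) (x : real_name) : fprop P :=
  (forallf i, fpure (i < size s) ->f
     if nth false s i then fbit x i else ~f fbit x i)%F.

End Reals.

(* A ground model space with a base of open sets indexed by codes, together with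
   its version in the extension: names for the points, and the equality and the
   membership in the basic open set with a given code. *)
Record fspace d (P : preorderType d) : Type := FSpace {
  ground : topologicalType;
  code : Type;
  basic : code -> set ground;
  point_name : Type;
  point_eq : point_name -> point_name -> fprop P;
  fbasic : code -> point_name -> fprop P
}.

Definition cantor_fspace d (P : preorderType d) : fspace P :=
  {| ground := cantor_space;
     code := seq bool;
     basic := cylinder;
     point_name := real_name P;
     point_eq := @real_eq d P;
     fbasic := @fcylinder d P |}.

(* Since the set of natural numbers acquires no new elements, its elements in
   the extension are represented by ground model naturals: every name for a
   natural number is decided on a dense set of conditions. *)
Definition omega_cantor_fspace d (P : preorderType d) : fspace P :=
  {| ground := (nat * cantor_space)%type;
     code := nat * seq bool;
     basic := fun c => [set c.1] `*` cylinder c.2;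
     point_name := nat * real_name P;
     point_eq := fun z w => (fpure (z.1 = w.1) /\f real_eq z.2 w.2)%F;
     fbasic := fun c z => (fpure (z.1 = c.1) /\f fcylinder c.2 z.2)%F |}.

Section Extension.
Context {d : Order.disp_t} {P : preorderType d} (X : fspace P).

(* A name for an arbitrary subset of the space computed in the extension: a set
   of pairs (name of a point, condition). *)
Definition subset_name : Type := set (point_name X * P).

Definition fmem (A : subset_name) (z : point_name X) : fprop P :=
  dense_below (fun q => exists w r,
    [/\ A (w, r), (q <= r)%O & point_eq z w q]).

(* Subsets of the space definable in the forcing language, with [fmem A]
   for a name [A] as a particular case. *)
Implicit Types A B : point_name X -> fprop P.

Definition fsubset A B : fprop P := (forallf z, A z ->f B z)%F.

Definition finterior A (z : point_name X) : fprop P :=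
  (existsf c, fbasic c z /\f fsubset (fbasic c) A)%F.

Definition fclosure A (z : point_name X) : fprop P :=
  (forallf c, fbasic c z ->f existsf w, fbasic c w /\f A w)%F.

Definition fopen A : fprop P := fsubset A (finterior A).

Definition fclosed A : fprop P := fsubset (fclosure A) A.

Definition fclopen A : fprop P := (fopen A /\f fclosed A)%F.

Definition fnowhere_dense A : fprop P :=
  (forallf z, ~f finterior (fclosure A) z)%F.

(* The set of the extension with the same code as an open set [U] of the ground
   model: the union of the basic open sets included in [U]. For a closed set,
   the complement of the reinterpreted complement. *)
Definition open_reinterp (U : set (ground X)) (z : point_name X) : fprop P :=
  (existsf c, fpure (basic c `<=` U) /\f fbasic c z)%F.

Definition closed_reinterp (B : set (ground X)) (z : point_name X) : fprop P :=
  (~f open_reinterp (~` B) z)%F.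

(* Families of subsets of the space in the extension. *)
Implicit Type G : subset_name -> fprop P.

Definition fclopen_filter G : fprop P :=
  ((forallf W, G W ->f fclopen (fmem W)) /\f
   (forallf W, (forallf z, fmem W z) ->f G W) /\f
   (forallf W, (forallf z, ~f fmem W z) ->f ~f G W) /\f
   (forallf V W U, G V ->f G W ->f
      (forallf z, (fmem U z ->f fmem V z /\f fmem W z) /\f
                  (fmem V z /\f fmem W z ->f fmem U z)) ->f G U) /\f
   (forallf V W, G V ->f fsubset (fmem V) (fmem W) ->f fclopen (fmem W) ->f
      G W))%F.

Definition fremote_filter G : fprop P :=
  (fclopen_filter G /\f
   forallf N : subset_name, fnowhere_dense (fmem N) ->f
     existsf V, G V /\f (forallf z, ~f (fmem V z /\f fmem N z)))%F.

(* The filter of clopen sets generated in the extension by the reinterpreted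
   members of a ground model family [F] of clopen sets: the clopen sets including
   the intersection of finitely many of them (a finite subset of [F] in the
   extension is in the ground model). *)
Definition fgenerated (F : set (set (ground X))) (W : subset_name) : fprop P :=
  (fclopen (fmem W) /\f
   existsf D : set (set (ground X)),
     fpure (finite_set D /\ D `<=` F) /\f
     (forallf z, (forallf V, fpure (D V) ->f open_reinterp V z) ->f
        fmem W z))%F.

End Extension.

Definition nwd_bounding d (P : preorderType d) : Prop :=
  forall (p : P) (A : subset_name (cantor_fspace P)),
    (fclosed (fmem A) /\f fnowhere_dense (fmem A))%F p ->
    exists (B : set cantor_space) (q : P),
      [/\ closed B, nowhere_dense B, (q <= p)%O &
          fsubset (fmem A) (closed_reinterp (X := cantor_fspace P) B) q].

(* Main.v *)
Require Import Defs.
From mathcomp Require Import all_boot all_order.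
From mathcomp Require Import all_classical all_reals topology cantor.

(** The space of pairs [(n, x)] embeds as an open subset in the Cantor set: send
    [(n, x)] to the sequence [0^n 1 x]. In the extension let [N] be nowhere dense
    and let [A] be the closure of its image. An open set included in [A]
    includes a cylinder of the form [0^n 1 t], which would make [N] dense
    in the basic open set with code [(n, t)]; so [A] is closed and nowhere dense
    ([fnowhere_dense_embed_closure]), and nwd-boundingness covers [A] by (the
    reinterpretation of) a closed nowhere dense set [B] of the ground model.
    The preimage of [B] under the embedding is nowhere dense
    ([nowhere_dense_embed]), so remoteness of [F] yields [V] in [F] disjoint
    from it. If a point [(n, x)] of the extension were in both [V] and [N], some
    ground model cylinder [0^n 1 t] with [(n, t)] coding a part of [V] would
    contain [0^n 1 x], a point of [B], although this cylinder is disjoint from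
    [B] ([fdisjoint_reinterp]).

    It remains to see that the reinterpretation of [F] generates a clopen
    filter. Properness is absoluteness of a finite intersection: a ground model
    point of the intersection keeps belonging to it. The only step where
    compactness enters is that a clopen [V] stays closed
    ([fclosed_open_reinterp]): on the slice at [n], membership in [V] depends on
    finitely many coordinates ([clopen_uniform]), and these are decided by a
    dense set of conditions ([fcylinder_decide]), so the reinterpretations of
    [V] and of its complement still cover the whole slice.

    Two devices replace the passage to a generic filter. A condition [p] and a
    name [x] for a real determine a ground model real lying in every cylinder in
    which [p] forces [x] to be ([fcylinder_shadow]); relations between cylinders
    are read off from it. And a class of names defined by a formula that is
    decided densely and respects equality is the extension of a name
    ([fmem_name_of]). *)

Set Implicit Arguments.
Unset Strict Implicit.
Unset Printing Implicit Defensive.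

(* Importing the definitions again gives [fclosure] back its meaning of closure
   in the extension, instead of closure under a function on a finite type. *)
Import Order.PreorderTheory Defs.
Local Open Scope classical_set_scope.

(** * Cylinders and clopen sets of the ground model *)

Lemma cylinder_mkseqP (x y : cantor_space) m :
  cylinder (mkseq x m) y <-> (forall i, i < m -> y i = x i).
Proof.
rewrite /cylinder /= size_mkseq.
by split=> h i im; move: (h i im); rewrite nth_mkseq.
Qed.

Lemma open_cylinder s : open (cylinder s).
Proof.
have -> : cylinder s =
    \bigcap_(i in `I_(size s))
      ((fun x : cantor_space => x i) @^-1` [set nth false s i]).
  by apply/seteqP; split=> x xs i /= si; exact: xs.
elim: (size s) => [|n IH].
  by rewrite II0 bigcap_set0; exact: openT.
rewrite IIS bigcap_setU bigcap_set1; apply: openI => //.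
apply: open_comp; last exact: discrete_open.
by move=> x _; exact: (@proj_continuous _ (fun _ : nat => bool) n).
Qed.

(** The filter generated by the cylinders around [x] converges to [x] in each
    coordinate, hence in the product topology. *)
Lemma nbhs_cylinder (x : cantor_space) (U : set cantor_space) :
  nbhs x U -> exists m, cylinder (mkseq x m) `<=` U.
Proof.
pose G := filter_from [set: nat] (fun m => cylinder (mkseq x m)).
have FG : Filter G.
  apply: filter_from_filter; first by exists 0.
  move=> i j _ _; exists (maxn i j) => // y /cylinder_mkseqP yx.
  by split; apply/cylinder_mkseqP => k kl; apply: yx; rewrite leq_max kl ?orbT.
have Gx : G --> x.
  apply/cvg_sup => i W [V] [[A] oA <-] Ax VW.
  exists i.+1 => // y /cylinder_mkseqP yx; apply: VW => /=.
  by rewrite yx.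
by move=> /Gx[m _ mU]; exists m.
Qed.

(** Inclusion of cylinders is a finite statement about their codes, which is why
    it is inherited by the extension ([fcylinder_sub]). *)
Lemma cylinder_subP s t : cylinder s `<=` cylinder t ->
  forall i, i < size t -> i < size s /\ nth false s i = nth false t i.
Proof.
move=> st i it.
(* Beyond [s] the point [x] disagrees with [t] everywhere, so that [t] cannot be
   longer than [s]. *)
pose x : cantor_space :=
  fun j => if j < size s then nth false s j else ~~ nth false t j.
have /st/(_ i it) : cylinder s x by move=> j js; rewrite /x js.
by rewrite /x; case: ltnP => // _; case: nth.
Qed.

Lemma cylinder_nested s t x : size s <= size t ->
  cylinder s x -> cylinder t x -> cylinder t `<=` cylinder s.
Proof.
move=> st xs xt y yt i si.
by rewrite yt ?(leq_trans si)// -xt ?(leq_trans si)// xs.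
Qed.

(** Compactness: deciding membership in [C] after finitely many bits is an open
    condition, monotone in the number of bits, so one number of bits works for
    all points. *)
Lemma clopen_uniform (C : set cantor_space) : clopen C ->
  exists m, forall s, size s = m -> cylinder s `<=` C \/ cylinder s `<=` ~` C.
Proof.
move=> [oC cC].
pose Q m (x : cantor_space) :=
  cylinder (mkseq x m) `<=` C \/ cylinder (mkseq x m) `<=` ~` C.
have : \forall m \near \oo, [set: cantor_space] `<=` Q m.
  apply: (iffLR (compact_near_coveringP _) cantor_space_compact) => x _.
  have [k xk] : exists k, Q k x.
    case: (pselect (C x)) => Cx.
      by have [k] := nbhs_cylinder (open_nbhs_nbhs (conj oC Cx)); exists k; left.
    have oC' : open (~` C) by exact: closed_openC.
    by have [k] := nbhs_cylinder (open_nbhs_nbhs (conj oC' Cx)); exists k; right.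
  exists (cylinder (mkseq x k), [set m | k <= m]).
    split=> /=; last by exists k.
    apply: open_nbhs_nbhs; split; first exact: open_cylinder.
    exact/cylinder_mkseqP.
  move=> [y m] /= [/cylinder_mkseqP yx km].
  have sub : cylinder (mkseq y m) `<=` cylinder (mkseq x k).
    move=> w /cylinder_mkseqP wy; apply/cylinder_mkseqP => i ik.
    by rewrite wy ?yx// (leq_trans ik).
  by case: xk => xk; [left|right]; exact: (subset_trans sub).
move=> [m _ /(_ m (leqnn m)) Cm]; exists m => s sm.
by have := Cm (nth false s) I; rewrite /Q -sm mkseq_nth.
Qed.

(** * Embedding the product into the Cantor set *)

(** The code [0^n 1 t]. *)
Definition stem n (t : seq bool) := nseq n false ++ true :: t.

(** The sequence [0^n 1 x]. *)
Definition embed n (x : cantor_space) : cantor_space :=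
  fun i => if i <= n then i == n else x (i - n.+1).

Lemma size_stem n t : size (stem n t) = n.+1 + size t.
Proof. by rewrite /stem size_cat size_nseq /= addnS. Qed.

Lemma nth_stem n t i : nth false (stem n t) i =
  if i <= n then i == n else nth false t (i - n.+1).
Proof.
rewrite nth_cat size_nseq nth_nseq if_same.
case: ltngtP => [//|ni|->]; last by rewrite subnn.
by rewrite -[i - n]prednK ?subn_gt0//= subnS.
Qed.

Lemma cylinder_embed n t x : cylinder (stem n t) (embed n x) <-> cylinder t x.
Proof.
split=> h i; last first.
  rewrite size_stem nth_stem /embed => it; case: leqP => // ni; apply: h.
  by rewrite ltn_subLR.
move=> it; have := h (n.+1 + i); rewrite size_stem ltn_add2l nth_stem /embed.
by rewrite addKn [_ <= n]leqNgt leq_addr; exact.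
Qed.

Lemma cylinder_stem n t y : cylinder (stem n t) y ->
  exists2 x, cylinder t x & embed n x = y.
Proof.
move=> yt; pose x : cantor_space := fun i => y (n.+1 + i).
have xy : embed n x = y.
  apply/funext => i; rewrite /embed /x; case: leqP => ni; last by rewrite subnKC.
  by rewrite yt ?nth_stem ?ni// size_stem addSn ltnS (leq_trans ni)// leq_addr.
by exists x => //; apply/(cylinder_embed n); rewrite xy.
Qed.

(** The sequences in which a 1 occurs are dense: complete [s] by a 1 if it has
    none, and split at its first 1 otherwise. *)
Lemma cylinder_stem_sub s : exists n t, cylinder (stem n t) `<=` cylinder s.
Proof.
case: (boolP (has id s)) => [st|/hasPn sF]; last first.
  exists (size s), [::] => y ys i si; rewrite ys ?size_stem ?addn0 ?leqW//.
  rewrite nth_stem (ltnW si) ltn_eqF//; apply/esym/negbTE/sF; exact: mem_nth.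
exists (find id s), (drop (find id s).+1 s).
suff -> : stem (find id s) (drop (find id s).+1 s) = s by [].
apply: (@eq_from_nth _ false).
  by rewrite size_stem size_drop subnKC// -has_find.
move=> i _; rewrite nth_stem nth_drop; case: ltngtP => [i_lt|lt_i|->].
- by rewrite (before_find false i_lt : nth false s i = false).
- by rewrite subnKC.
- by rewrite (nth_find false st : nth false s (find id s) = true).
Qed.

Definition omega_basic (c : nat * seq bool) : set (nat * cantor_space)%type :=
  [set c.1] `*` cylinder c.2.

Lemma open_omega_basic c : open (omega_basic c).
Proof.
move=> z [/= zn zc]; exists ([set c.1], cylinder c.2) => //; split=> /=.
  by rewrite -zn; exact: discrete_set1.
by apply: open_nbhs_nbhs; split=> //; exact: open_cylinder.
Qed.

Lemma open_omega_cantorP (U : set (nat * cantor_space)%type) : open U <->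
  (forall z, U z -> exists2 c, omega_basic c z & omega_basic c `<=` U).
Proof.
split=> [oU [n x] Unx|h].
  have [[A B] /= [An Bx] ABU] : nbhs (n, x) U.
    exact: (open_nbhs_nbhs (conj oU Unx)).
  have [m mB] := nbhs_cylinder Bx.
  exists (n, mkseq x m); first by split=> //=; exact/cylinder_mkseqP.
  move=> [k y] [/= -> /mB By]; apply: ABU; split=> //=.
  exact: nbhs_singleton.
rewrite openE => z /h[c cz cU]; apply: (@filterS _ (nbhs z) _ _ _ cU).
by apply: open_nbhs_nbhs; split=> //; exact: open_omega_basic.
Qed.

Lemma clopen_slice (V : set (nat * cantor_space)%type) n : clopen V ->
  clopen [set x | V (n, x)].
Proof.
have os (U : set (nat * cantor_space)%type) : open U -> open [set x | U (n, x)].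
  move=> /open_omega_cantorP oU; rewrite openE => x /= /oU[c [/= nc xc] cU].
  apply: (@filterS _ _ _ (cylinder c.2)); first by move=> y yc; exact: cU.
  by apply: open_nbhs_nbhs; split=> //; exact: open_cylinder.
move=> [oV cV]; split; first exact: os.
by rewrite -openC; apply: (os (~` V)); rewrite openC.
Qed.

(** The embedding is continuous and maps basic open sets onto cylinders. So the
    preimage of [B] is closed, and an open set inside it would give a cylinder
    inside [B]. *)
Lemma nowhere_dense_embed (B : set cantor_space) :
  closed B -> nowhere_dense B ->
  nowhere_dense [set z : (nat * cantor_space)%type | B (embed z.1 z.2)].
Proof.
move=> cB nB; set N := [set z | _].
have cN : closed N.
  rewrite -openC; apply/open_omega_cantorP => -[n x] nBx.
  have oB : open (~` B) by exact: closed_openC.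
  have [m mB] := nbhs_cylinder (open_nbhs_nbhs (conj oB nBx)).
  exists (n, mkseq x m); first by split=> //=; exact/cylinder_mkseqP.
  move=> [k y] [/= -> /cylinder_mkseqP yx]; apply: mB.
  apply/cylinder_mkseqP => i im; rewrite /embed /=; case: leqP => // ni.
  by apply: yx; rewrite (leq_ltn_trans _ im)// leq_subr.
rewrite /nowhere_dense -(closure_id N).1//; apply/eqP; apply: contraT => /set0P[z].
have := @open_interior _ N => /open_omega_cantorP/[apply] -[[n t] [/= zn zt] ntN].
suff : interior (closure B) (embed n z.2) by rewrite nB.
rewrite -(closure_id B).1//; apply: (@filterS _ _ _ (cylinder (stem n t))).
  move=> y /cylinder_stem[x xt <-].
  by have /ntN/interior_subset : omega_basic (n, t) (n, x) by [].
apply: open_nbhs_nbhs; split; first exact: open_cylinder.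
exact/cylinder_embed.
Qed.

(** * Persistence and density of formulas *)

Section Forcing.
Context {d : Order.disp_t} {P : preorderType d}.
Implicit Types (phi psi : fprop P) (p q r : P).

Definition persistent phi := forall p q, (q <= p)%O -> phi p -> phi q.

(** The sets of conditions that are truth values in the Boolean completion of
    [P]; they are automatically persistent. *)
Definition regular phi := forall p, dense_below phi p <-> phi p.

Lemma persistent_dense_below phi : persistent (dense_below phi).
Proof. by move=> p q qp h r rq; apply: h; exact: le_trans rq qp. Qed.

Lemma persistent_fimp phi psi : persistent (phi ->f psi)%F.
Proof. by move=> p q qp h r rq; apply: h; exact: le_trans rq qp. Qed.

Lemma persistent_fnot phi : persistent (~f phi)%F.
Proof. by move=> p q qp h r rq; apply: h; exact: le_trans rq qp. Qed.

Lemma persistent_fand phi psi :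
  persistent phi -> persistent psi -> persistent (phi /\f psi)%F.
Proof. by move=> m1 m2 p q qp [/(m1 _ _ qp) h1 /(m2 _ _ qp)]. Qed.

Lemma persistent_fall (I : Type) (phi : I -> fprop P) :
  (forall i, persistent (phi i)) -> persistent (fall phi).
Proof. by move=> m p q qp h i; exact: m qp (h i). Qed.

Lemma regular_persistent phi : regular phi -> persistent phi.
Proof. by move=> r p q qp /r h; apply/r; exact: persistent_dense_below h. Qed.

Lemma dense_below_self phi p : persistent phi -> phi p -> dense_below phi p.
Proof. by move=> m h q qp; exists q => //; exact: m h. Qed.

Lemma regular_dense_below phi : regular (dense_below phi).
Proof.
move=> p; split; last exact: dense_below_self (@persistent_dense_below _).
move=> h q /h[r rq /(_ r (lexx r))[s sr ?]]; exists s => //.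
exact: le_trans sr rq.
Qed.

Lemma regular_fimp phi psi :
  persistent phi -> regular psi -> regular (phi ->f psi)%F.
Proof.
move=> mphi rpsi p; split; last exact: dense_below_self (@persistent_fimp _ _).
move=> h q qp hq; apply/rpsi => r rq.
have [s sr hs] := h r (le_trans rq qp); exists s => //.
by apply: hs => //; apply: mphi hq; exact: le_trans sr rq.
Qed.

Lemma regular_fall (I : Type) (phi : I -> fprop P) :
  (forall i, regular (phi i)) -> regular (fall phi).
Proof.
move=> rphi p; split=> [h i|].
  by apply/rphi => q /h[r rq ?]; exists r.
apply: dense_below_self; apply: persistent_fall => i.
exact: regular_persistent.
Qed.

End Forcing.

(** * Names and closures in an arbitrary space of the extension *)

Section Names.
Context {d : Order.disp_t} {P : preorderType d} (X : fspace P).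
Implicit Types (p q r : P) (z w : point_name X) (A B : point_name X -> fprop P).

(** The forced laws of equality and of basic open sets on which the generic
    arguments about closures and reinterpretations rest. *)
Record lawful : Prop := Lawful {
  point_eq_refl : forall z p, point_eq z z p;
  point_eq_sym : forall z w p, point_eq z w p -> point_eq w z p;
  persistent_point_eq : forall z w, persistent (point_eq z w);
  persistent_fbasic : forall c z, persistent (@fbasic _ _ X c z);
  fbasic_eq : forall c z w p, point_eq z w p -> fbasic c w p -> fbasic c z p
}.

Lemma persistent_fmem (N : subset_name X) z : persistent (fmem N z).
Proof. exact: persistent_dense_below. Qed.

Lemma persistent_fsubset A B : persistent (fsubset A B).
Proof. by apply: persistent_fall => z; exact: persistent_fimp. Qed.

Lemma persistent_fclopen A : persistent (fclopen A).
Proof. by apply: persistent_fand; exact: persistent_fsubset. Qed.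

Lemma persistent_fnowhere_dense A : persistent (fnowhere_dense A).
Proof. by apply: persistent_fall => z; exact: persistent_fnot. Qed.

Lemma persistent_fgenerated F (W : subset_name X) : persistent (fgenerated F W).
Proof.
by apply: persistent_fand;
  [exact: persistent_fclopen|exact: persistent_dense_below].
Qed.

Lemma fsubset_trans A B C p : fsubset A B p -> fsubset B C p -> fsubset A C p.
Proof. by move=> AB BC z q qp Az; apply: BC => //; exact: AB. Qed.

Lemma fclosureS A B p : fsubset A B p -> fsubset (fclosure A) (fclosure B) p.
Proof.
move=> AB z q qp Az c r rq cz s sr; have [t ts [w [cw Aw]]] := Az c r rq cz s sr.
exists t => //; exists w; split=> //; apply: AB => //.
exact: le_trans (le_trans ts sr) (le_trans rq qp).
Qed.

Lemma fclosed_fclosure A p : fclosed (fclosure A) p.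
Proof.
move=> z q qp h c r rq cz; apply/regular_dense_below => s sr.
have [t ts [w [cw Aw]]] := h c r rq cz s sr.
by exists t => //; exact: Aw (lexx t) cw.
Qed.

(** Comprehension in the extension: the candidate name for a definable set. *)
Definition name_of A : subset_name X := [set zp | A zp.1 zp.2].

Hypothesis lX : lawful.

(** Membership in [name_of A] is forced as soon as it holds densely and up to
    equality; both closures do nothing to [A] under the two hypotheses. *)
Lemma fmem_name_of A : (forall z, regular (A z)) ->
  (forall z w p, point_eq z w p -> A w p -> A z p) ->
  fmem (name_of A) = A.
Proof.
move=> rA eA; apply/funext => z; apply/funext => p; apply/propext; split.
  move=> h; apply/rA => q /h[r rq [w [s [Aws rs zw]]]]; exists r => //.
  by apply: eA zw _; exact: regular_persistent Aws.
move=> Az q qp; exists q => //; exists z, q; split=> //.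
  exact: regular_persistent Az.
exact: point_eq_refl.
Qed.

Lemma subset_fclosure A p : (forall z, persistent (A z)) ->
  fsubset A (fclosure A) p.
Proof.
move=> mA z q qp Az c r rq cz s sr; exists s => //; exists z; split.
  exact: persistent_fbasic cz.
by apply: mA Az; exact: le_trans sr rq.
Qed.

Lemma fmem_name_of_fclosure A : fmem (name_of (fclosure A)) = fclosure A.
Proof.
apply: fmem_name_of => [z|z w p zw Aw c q qp cz].
  apply: regular_fall => c; apply: regular_fimp.
    exact: persistent_fbasic.
  exact: regular_dense_below.
apply: Aw => //; apply: fbasic_eq cz => //; apply: point_eq_sym => //.
exact: persistent_point_eq zw.
Qed.

Lemma fmem_name_of_open_reinterp U :
  fmem (name_of (open_reinterp U)) = open_reinterp U.
Proof.
apply: fmem_name_of => [z|z w p zw Uw q qp]; first exact: regular_dense_below.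
have [r rq [c [cU cw]]] := Uw q qp; exists r => //; exists c; split=> //.
apply: fbasic_eq cw => //; apply: persistent_point_eq zw => //.
exact: le_trans rq qp.
Qed.

Lemma fopen_open_reinterp U p : fopen (@open_reinterp _ _ X U) p.
Proof.
move=> z q qp Uz r rq; have [s sr [c [cU cz]]] := Uz r rq.
exists s => //; exists c; split=> // w t ts cw u ut; exists u => //.
by exists c; split=> //; exact: persistent_fbasic cw.
Qed.

End Names.

(** * Names for reals *)

Section Reals.
Context {d : Order.disp_t} {P : preorderType d}.
Implicit Types (p q r : P) (x y : real_name P) (s t : seq bool).

Lemma fcylinderP s x p : fcylinder s x p <-> forall i, i < size s ->
  (if nth false s i then fbit x i else ~f fbit x i)%F p.
Proof.
split=> [h i si|h i q qp si]; first exact: h (lexx p) si.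
have := h i si; case: nth; [exact: persistent_dense_below|exact: persistent_fnot].
Qed.

Lemma persistent_fcylinder s x : persistent (fcylinder s x).
Proof. by apply: persistent_fall => i; exact: persistent_fimp. Qed.

Lemma fcylinder_eq s x y p : real_eq x y p -> fcylinder s y p -> fcylinder s x p.
Proof.
move=> xy /fcylinderP sy; apply/fcylinderP => i /sy; have [xyi yxi] := xy i.
case: nth; first exact: yxi.
by move=> ny q qp xq; apply: (ny q) => //; exact: xyi.
Qed.

Lemma real_eq_refl x p : real_eq x x p.
Proof. by move=> n; split. Qed.

Lemma real_eq_sym x y p : real_eq x y p -> real_eq y x p.
Proof. by move=> xy n; have [] := xy n. Qed.

Lemma persistent_real_eq x y : persistent (real_eq x y).
Proof.
by apply: persistent_fall => n; apply: persistent_fand; exact: persistent_fimp.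
Qed.

Lemma lawful_cantor : lawful (cantor_fspace P).
Proof.
split=> /=.
- exact: real_eq_refl.
- exact: real_eq_sym.
- exact: persistent_real_eq.
- exact: persistent_fcylinder.
- exact: fcylinder_eq.
Qed.

Lemma lawful_omega_cantor : lawful (omega_cantor_fspace P).
Proof.
split=> /=.
- by move=> z p; split=> //; exact: real_eq_refl.
- by move=> z w p [-> zw]; split=> //; exact: real_eq_sym.
- by move=> z w; apply: persistent_fand => //; exact: persistent_real_eq.
- by move=> c z; apply: persistent_fand => //; exact: persistent_fcylinder.
- move=> c z w p [zw1 zw2] [wc1 wc2].
  by split; [exact: etrans wc1|exact: fcylinder_eq wc2].
Qed.

Lemma fcylinder_sub s t x p :
  cylinder s `<=` cylinder t -> fcylinder s x p -> fcylinder t x p.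
Proof.
move=> st /fcylinderP sx; apply/fcylinderP => i /(cylinder_subP st)[si <-].
exact: sx.
Qed.

(** The bits of the witness are the bits of [x] that [p] forces to be 1. Bits
    that [p] leaves undecided are irrelevant, since [p] forces [x] into a
    cylinder only if it decides all the bits concerned. *)
Lemma fcylinder_shadow x p :
  exists y : cantor_space, forall s, fcylinder s x p -> cylinder s y.
Proof.
exists (fun i => `[< fbit x i p >]) => s /fcylinderP h i /h.
by case: nth => [/asboolP //|nx]; apply/asboolP; exact: nx.
Qed.

Lemma fcylinder_decide x p m :
  exists2 q, (q <= p)%O & exists2 s, size s = m & fcylinder s x q.
Proof.
elim: m => [|m [q qp [s sm sx]]]; first by exists p => //; exists [::].
have [b [r rq bx]] : exists b, exists2 r, (r <= q)%O &
    (if b then fbit x m else ~f fbit x m)%F r.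
  have [[r rq xr]|nx] := pselect (exists2 r, (r <= q)%O & fbit x m r).
    by exists true, r.
  by exists false, q => // r rq xr; apply: nx; exists r.
exists r; first exact: le_trans rq qp.
exists (rcons s b); first by rewrite size_rcons sm.
apply/fcylinderP => i; rewrite size_rcons nth_rcons sm.
rewrite ltnS => im; case: ltngtP im => // [im _|-> _ //].
have /fcylinderP/(_ i) := persistent_fcylinder rq sx.
by rewrite sm; exact.
Qed.

(** The canonical name of a ground model real. *)
Definition check_real (y : cantor_space) : real_name P := [set np | y np.1].

Lemma fbit_check (y : cantor_space) n p : fbit (check_real y) n p <-> y n.
Proof.
split=> [/(_ p (lexx p))[q _ []]//|yn q qp].
by exists q => //; exists q.
Qed.

Lemma fcylinder_check s (y : cantor_space) p :
  cylinder s y -> fcylinder s (check_real y) p.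
Proof.
move=> sy; apply/fcylinderP => i /sy; case: nth => yi; first exact/fbit_check.
by move=> q _ /fbit_check; rewrite yi.
Qed.

(** The name of [0^n 1 x] computed from a name of [x]; the bit 1 at position [n]
    is put in by all conditions. *)
Definition embed_real n x : real_name P :=
  [set ir | if ir.1 <= n then ir.1 == n : Prop else x (ir.1 - n.+1, ir.2)].

Lemma fbit_embed n x i p : fbit (embed_real n x) i p <->
  if i <= n then i == n : Prop else fbit x (i - n.+1) p.
Proof.
rewrite /fbit /embed_real /=; case: leqP => // _; split.
  by move=> /(_ p (lexx p))[q _ []].
by move=> ni q _; exists q => //; exists q.
Qed.

(** The position of the first 1 is determined by the code, so [n = m] is decided
    outright and not only densely. *)
Lemma fcylinder_embed n t m x p :
  fcylinder (stem n t) (embed_real m x) p <-> n = m /\ fcylinder t x p.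
Proof.
split=> [/fcylinderP h|[<- /fcylinderP h]]; last first.
  apply/fcylinderP => i; rewrite size_stem nth_stem => it.
  have := @fbit_embed n x i.
  case: leqP => [_|ni] E.
    by case: eqP E => _ E; [exact/E|move=> q _ /E].
  have /h : i - n.+1 < size t by rewrite ltn_subLR.
  by case: nth => [?|nx q qp /E]; [exact/E|exact: nx].
have nm : n = m.
  case: (ltngtP n m) => // [nm|mn].
    have := h n; rewrite size_stem nth_stem leqnn eqxx addSn ltnS leq_addr.
    move=> /(_ isT)/fbit_embed; rewrite ltnW// => /eqP nm'.
    by move: nm; rewrite nm' ltnn.
  have := h m; rewrite size_stem nth_stem (ltnW mn) (ltn_eqF mn) addSn ltnS.
  rewrite (leq_trans (ltnW mn)) ?leq_addr// => /(_ isT p (lexx p)) []//.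
  by apply/fbit_embed; rewrite leqnn.
split=> //; apply/fcylinderP => i it; move: h; rewrite -nm => h.
have := h (n.+1 + i); rewrite size_stem ltn_add2l nth_stem => /(_ it).
have := @fbit_embed n x (n.+1 + i).
rewrite addKn leqNgt addSn ltnS leq_addr /= => E.
by case: nth => [/E//|nx q qp /E]; exact: nx.
Qed.

End Reals.

(** * Clopen sets and the generated filter in the extension *)

Section Remote.
Context {d : Order.disp_t} {P : preorderType d}.
Implicit Types (p q r : P) (F : set (set (nat * cantor_space)%type)).

Notation X := (omega_cantor_fspace P).

Lemma open_reinterp_check (U : set (ground X)) n (y : cantor_space) p :
  open U -> U (n, y) -> open_reinterp (X := X) U (n, check_real y) p.
Proof.
move=> /open_omega_cantorP oU /oU[[m s] [/= -> sy] cU] q qp.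
exists q => //; exists (m, s); split=> //; split=> //.
exact: fcylinder_check.
Qed.

(** A point of the closure of [V] has its first [m] bits decided densely, and
    they place it in a basic open set included in [V] or disjoint from it. The
    second case is impossible, because that basic open set meets [V] in the
    extension, and then so do the ground model shadows. *)
Lemma fclosed_open_reinterp (V : set (ground X)) p :
  clopen V -> fclosed (open_reinterp (X := X) V) p.
Proof.
move=> cV [n x] q qp h; apply/regular_dense_below => q' q'q.
have [m Vm] := clopen_uniform (clopen_slice n cV).
have [r rq' [s sm sx]] := fcylinder_decide x q' m.
have rq := le_trans rq' q'q.
exists r => //; case: (Vm s sm) => sV t tr.
  exists t => //; exists (n, s); split; last first.
    by split=> //=; exact: persistent_fcylinder sx.
  by move=> [k y] [/= -> /sV].
have [u ut [[k w] [[/= kn sw] Vw]]] := h (n, s) r rq (conj erefl sx) t tr.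
have [v vu [[l s'] [cV' [/= kl sw']]]] := Vw u (lexx u).
(* The shadow of [w] lies in both cylinders, hence in [V] and outside it. *)
have [y yw] := fcylinder_shadow w v.
have /sV /= := yw _ (persistent_fcylinder vu sw); case.
by apply: cV'; split=> /=; [rewrite -kl -kn|exact: yw].
Qed.

Lemma fclopen_open_reinterp (V : set (ground X)) p :
  clopen V -> fclopen (open_reinterp (X := X) V) p.
Proof.
move=> cV; split; last exact: fclosed_open_reinterp.
exact/fopen_open_reinterp/lawful_omega_cantor.
Qed.

Lemma fclopenT (A : point_name X -> fprop P) p : (forall z, A z p) ->
  (forall z, persistent (A z)) -> fclopen A p.
Proof.
move=> AT mA; split=> [z q qp _ r rq|z q qp _]; last exact: mA (AT z).
exists r => //; exists (z.1, [::]); split=> [|w s sr _].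
  by split=> //; apply/fcylinderP.
by apply: mA (AT w); exact: le_trans sr (le_trans rq qp).
Qed.

(** Two cylinders around one point are nested, so the smaller one witnesses that
    the point is interior to both sets. The hypothesis on [C] is an equivalence
    below [p], as this is what the forcing language provides for a name of the
    intersection. *)
Lemma fopenI (A B C : point_name X -> fprop P) p :
  fopen A p -> fopen B p ->
  (forall z q, (q <= p)%O -> C z q <-> A z q /\ B z q) -> fopen C p.
Proof.
move=> oA oB CAB z q qp /(CAB _ _ qp)[Az Bz] r rq.
have [s sr [[n a] [[/= zn az] aA]]] := oA z q qp Az r rq.
have [t ts [[m b] [[/= zm bz] bB]]] := oB z q qp Bz s (le_trans sr rq).
have tp := le_trans (le_trans ts sr) (le_trans rq qp).
exists t; first exact: le_trans ts sr.
have {}az := persistent_fcylinder ts az.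
have [y yz] := fcylinder_shadow z.2 t.
have [c [cz ca cb]] : exists c, [/\ fcylinder c z.2 t,
    cylinder c `<=` cylinder a & cylinder c `<=` cylinder b].
  case: (leqP (size a) (size b)) => [ab|/ltnW ba].
    by exists b; split=> //; exact: (cylinder_nested ab (yz _ az) (yz _ bz)).
  by exists a; split=> //; exact: (cylinder_nested ba (yz _ bz) (yz _ az)).
exists (n, c); split=> // w u ut [/= wn cw].
apply/CAB; first exact: le_trans ut tp.
split; [apply: aA|apply: bB] => //.
- exact: le_trans ut ts.
- by split=> //=; exact: fcylinder_sub cw.
- by split=> /=; [rewrite wn -zn|exact: fcylinder_sub cw].
Qed.

Lemma fclosedI (A B C : point_name X -> fprop P) p :
  fclosed A p -> fclosed B p ->
  (forall z q, (q <= p)%O -> C z q <-> A z q /\ B z q) -> fclosed C p.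
Proof.
move=> cA cB CAB z q qp Cz; apply/CAB => //; split.
  apply: cA => //; apply: fclosureS Cz; last exact: qp.
  by move=> w r rp /(CAB _ _ rp)[].
apply: cB => //; apply: fclosureS Cz; last exact: qp.
by move=> w r rp /(CAB _ _ rp)[].
Qed.

Lemma filter_finite_bigcap F (D : set (set (ground X))) :
  clopen_filter F -> finite_set D -> D `<=` F -> F (\bigcap_(V in D) V).
Proof.
move=> [_ FT _ FI _] /finite_seqP[s ->] sF.
rewrite bigcap_seq big_seq; elim/big_rec: _ => // V W Vs FW.
by apply: FI => //; exact: sF.
Qed.

(** Besides the stability of clopen sets under intersection, only properness
    needs more than bookkeeping of the finite sets of generators: a condition
    forcing a member to be empty would force it to contain the canonical name of
    a ground model point of the intersection of its generators. *)
Lemma fclopen_filter_fgenerated F p :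
  clopen_filter F -> fclopen_filter (fgenerated (X := X) F) p.
Proof.
move=> FF; split; [|split; [|split; [|split]]].
- by move=> W q qp [].
- move=> W q qp WT; split.
    by apply: fclopenT => // z; exact: persistent_fmem.
  move=> r rq; exists r => //; exists set0; split.
    by split=> //; exact: finite_set0.
  by move=> z s sr _; apply: persistent_fmem (WT z); exact: le_trans sr rq.
- move=> W q qp W0 r rq [_ /(_ r (lexx r))[s sr [D [[fD DF] DW]]]].
  have FD := filter_finite_bigcap FF fD DF.
  have [Fc _ F0 _ _] := FF.
  have [[n y] Dy] : \bigcap_(V in D) V !=set0.
    by apply/set0P/negP => /eqP D0; apply: F0; rewrite -D0.
  apply: (W0 (n, check_real y) s (le_trans sr rq)).
  apply: DW => // V t ts DV; apply: open_reinterp_check; last exact: Dy.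
  by have [] := Fc _ (DF _ DV).
- move=> V W U q qp GV r rq GW s sr VWU.
  have VWUE z t : (t <= s)%O -> fmem U z t <-> fmem V z t /\ fmem W z t.
    by move=> ts; have [h1 h2] := VWU z; split; [exact: h1|exact: h2].
  have [[oV cV] GV'] := persistent_fgenerated (le_trans sr rq) GV.
  have [[oW cW] GW'] := persistent_fgenerated sr GW.
  split; first by split; [exact: fopenI oV oW _|exact: fclosedI cV cW _].
  move=> t ts; have [u ut [D [[fD DF] DV]]] := GV' t ts.
  have us := le_trans ut ts.
  have [v vu [E [[fE EF] EW]]] := GW' u us.
  exists v; first exact: le_trans vu ut.
  exists (D `|` E); split.
    by split; [rewrite finite_setU|move=> Z [/DF|/EF]].
  move=> z a av h; apply/VWUE; first exact: le_trans av (le_trans vu us).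
  split; [apply: DV|apply: EW] => //; first exact: le_trans av vu.
    by move=> Z b ba DZ; apply: h => //; left.
  by move=> Z b ba EZ; apply: h => //; right.
- move=> V W q qp GV r rq VW s sr cW; split=> //.
  have [_ GV'] := persistent_fgenerated (le_trans sr rq) GV.
  move=> t ts; have [u ut [D [DF DV]]] := GV' t ts.
  exists u => //; exists D; split=> // z v vu h.
  apply: VW; first exact: le_trans (le_trans vu ut) (le_trans ts sr).
  exact: DV.
Qed.

(** * Remoteness in the extension *)

Definition embed_image (N : subset_name X) (y : real_name P) : fprop P :=
  (existsf z : point_name X, real_eq y (embed_real z.1 z.2) /\f fmem N z)%F.

Notation embed_closure N :=
  (fclosure (X := cantor_fspace P) (embed_image N)).

Lemma mem_embed_closure (N : subset_name X) (z : point_name X) p :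
  fmem N z p -> embed_closure N (embed_real z.1 z.2) p.
Proof.
move=> Nz; apply: (subset_fclosure lawful_cantor) (lexx p) _.
  by move=> y; exact: persistent_dense_below.
move=> q qp; exists q => //; exists z; split; first exact: real_eq_refl.
exact: persistent_fmem Nz.
Qed.

(** If [A], the closure of the image of [N], includes a cylinder, it includes
    one of the form [0^n 1 t]. Each point [0^n 1 x] of it is then approximated
    by images of points of [N], and those in a cylinder [0^n 1 u] come from
    points [(n, v)] with [v] in the cylinder [u]. Thus the basic open set of
    [(n, t)] is included in the closure of [N]. *)
Lemma fnowhere_dense_embed_closure (N : subset_name X) p :
  fnowhere_dense (fmem N) p ->
  fnowhere_dense (X := cantor_fspace P) (embed_closure N) p.
Proof.
move=> nN y q qp /(_ q (lexx q))[r rq [s [_ sA]]].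
have {}sA := fsubset_trans sA (@fclosed_fclosure _ _ _ _ r).
have [n [t ts]] := cylinder_stem_sub s.
(* Any point of the basic open set of [(n, t)] serves as an interior point of
   the closure of [N]; this one continues [t] by zeros. *)
apply: (nN (n, check_real (nth false t)) r (le_trans rq qp)) => r1 r1r.
exists r1 => //; exists (n, t); split.
  by split=> //; apply: fcylinder_check => i.
move=> [m x] r2 r21 [/= -> tx] [k u] r3 r32 [/= <- ux].
have emx : embed_closure N (embed_real n x) r2.
  apply: sA; first exact: le_trans r21 r1r.
  by apply: fcylinder_sub ts _; apply/fcylinder_embed.
have /(emx (stem n u) r3 r32) : fcylinder (stem n u) (embed_real n x) r3.
  exact/fcylinder_embed.
move=> h r4 /h[r5 r54 [w [uw /(_ r5 (lexx r5))[r6 r65 [[m' v] [/= wv Nv]]]]]].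
exists r6; first exact: le_trans r65 r54.
have /fcylinder_embed[nm uv] : fcylinder (stem n u) (embed_real m' v) r6.
  apply: fcylinder_eq (real_eq_sym wv) _; exact: persistent_fcylinder uw.
by exists (m', v).
Qed.

(** A point of [V] lies in a basic open set included in [V], whose image is a
    cylinder of the ground model disjoint from [B]; its image is therefore in
    the reinterpretation of the complement of [B]. *)
Lemma fdisjoint_reinterp (B : set cantor_space) (V : set (ground X))
    (N : subset_name X) p :
  V `&` [set z : ground X | B (embed z.1 z.2)] = set0 ->
  fsubset (embed_closure N) (closed_reinterp (X := cantor_fspace P) B) p ->
  forall z, (~f (open_reinterp V z /\f fmem N z))%F p.
Proof.
move=> VB NB z q qp [/(_ q (lexx q))[r rq [[n t] [tV [/= zn tz]]]] Nz].
have /NB : embed_closure N (embed_real z.1 z.2) q by exact: mem_embed_closure.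
move=> /(_ qp r rq); apply=> s sr; exists s => //; exists (stem n t); split.
  move=> y /cylinder_stem[x tx <-] Bx.
  suff : (set0 : set (ground X)) (n, x) by [].
  by rewrite -VB; split=> //; exact: tV.
by rewrite zn; apply/fcylinder_embed; split=> //; exact: persistent_fcylinder tz.
Qed.

(** The reinterpretation of a member of [F] has to be presented by a name in
    order to be a member of the generated filter. *)
Lemma fgenerated_open_reinterp F (V : set (ground X)) p :
  clopen V -> F V ->
  fgenerated (X := X) F (name_of (open_reinterp (X := X) V)) p.
Proof.
move=> cV FV; rewrite /fgenerated fmem_name_of_open_reinterp; last first.
  exact: lawful_omega_cantor.
split; first exact: fclopen_open_reinterp.
move=> q qp; exists q => //; exists [set V]; split.
  by split; [exact: finite_set1|move=> _ ->].
by move=> z r rq; exact.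
Qed.

End Remote.

Theorem theorem4p3 (d : Order.disp_t) (P : preorderType d)
    (F : set (set (nat * cantor_space)%type)) :
  remote_filter F ->
  nwd_bounding P ->
  forall p : P, fremote_filter (fgenerated (X := omega_cantor_fspace P) F) p.
Proof.
move=> [FF remF] bP p; split; first exact: fclopen_filter_fgenerated.
move=> N q qp nN r rq.
have {}nN := persistent_fnowhere_dense rq nN.
pose A := name_of (fclosure (X := cantor_fspace P) (embed_image N)).
have AE : fmem A = fclosure (X := cantor_fspace P) (embed_image N).
  exact/fmem_name_of_fclosure/lawful_cantor.
have [|B [s [cB nB sr AB]]] := bP r A.
  rewrite AE; split; first exact: fclosed_fclosure.
  exact: fnowhere_dense_embed_closure.
have [V FV VB] := remF _ (nowhere_dense_embed cB nB).
exists s => //; exists (name_of (open_reinterp (X := omega_cantor_fspace P) V)).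
split.
  by apply: fgenerated_open_reinterp => //; have [Fc _ _ _ _] := FF; exact: Fc.
rewrite fmem_name_of_open_reinterp; last exact: lawful_omega_cantor.
by apply: fdisjoint_reinterp VB _; rewrite -AE.
Qed.
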